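(* Let $t \geq 1$ be an integer, and let $G$ be a non-bipartite $(2t+1)$-regular graph. Then $G$ has a 1-factor $F$ such that $G-F$ is bipartite if and only if $F_c(G) = 2 + \frac{2}{2t-1}$.
   Context: Graphs are finite multigraphs (parallel edges are allowed), with vertex set $V(G)$ and edge set $E(G)$. A 1-factor of $G$ is a perfect matching, i.e. a set $F \subseteq E(G)$ such that every vertex is incident to exactly one edge of $F$; $G-F$ is the graph obtained from $G$ by deleting the edges of $F$. For an orientation $D$ of $G$ and $v \in V(G)$, $E^+(v)$ is the set of edges with tail $v$ and $E^-(v)$ is the set of edges with head $v$. For a real number $r \geq 2$, a nowhere-zero $r$-flow on $G$ is an orientation $D$ of $G$ together with a function $\phi : E(G) \to \mathbb{R}$ such that $1 \leq |\phi(e)| \leq r-1$ for all $e \in E(G)$ and $\sum_{e \in E^+(v)}\phi(e) = \sum_{e \in E^-(v)}\phi(e)$ for all $v \in V(G)$. The circular flow number of $G$ is $F_c(G) = \inf\{ r : G \text{ has a nowhere-zero } r\text{-flow}\}$ (with $F_c(G)=\infty$ if $G$ has no nowhere-zero $r$-flow for any $r$). *)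

(* Defs.v *)
From HB Require Import structures.
From mathcomp Require Import all_boot all_order all_algebra.
From mathcomp Require Import classical_sets reals ereal.

Set Implicit Arguments.
Unset Strict Implicit.
Unset Printing Implicit Defensive.

Import Order.TTheory GRing.Theory Num.Theory.

Local Open Scope ring_scope.

(* Parallel edges are distinct elements of [edge G] with the same set of ends;
   an edge has two distinct ends, so there are no loops. *)
Record multigraph := Multigraph {
  vertex : finType;
  edge : finType;
  ends : edge -> {set vertex};
  card_ends : forall e, #|ends e| = 2%N }.

Arguments ends {G} e : rename.

Definition degree (G : multigraph) (v : vertex G) : nat :=
  #|[set e : edge G | v \in ends e]|.

Definition regular (k : nat) (G : multigraph) : Prop :=
  forall v : vertex G, degree v = k.

Definition bipartite (G : multigraph) : Prop :=
  exists A : {set vertex G}, forall e : edge G,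
    #|ends e :&: A| = 1%N /\ #|ends e :&: ~: A| = 1%N.

Definition one_factor (G : multigraph) (F : {set edge G}) : Prop :=
  forall v : vertex G, #|[set e in F | v \in ends e]| = 1%N.

Definition delete_edges (G : multigraph) (F : {set edge G}) : multigraph :=
  @Multigraph (vertex G) {e : edge G | e \notin F}
    (fun e => ends (val e)) (fun e => card_ends (val e)).

Record orientation (G : multigraph) := Orientation {
  tail : edge G -> vertex G;
  head : edge G -> vertex G;
  ends_tail_head : forall e, ends e = [set tail e; head e] }.

Definition out_edges (G : multigraph) (D : orientation G) (v : vertex G) :
  {set edge G} := [set e | tail D e == v].

Definition in_edges (G : multigraph) (D : orientation G) (v : vertex G) :
  {set edge G} := [set e | head D e == v].

Definition nowhere_zero_flow (R : realType) (G : multigraph) (r : R)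
    (D : orientation G) (phi : edge G -> R) : Prop :=
  (forall e, 1 <= `|phi e| <= r - 1) /\
  (forall v, \sum_(e in out_edges D v) phi e = \sum_(e in in_edges D v) phi e).

Definition has_nowhere_zero_flow (R : realType) (G : multigraph) (r : R) : Prop :=
  exists (D : orientation G) (phi : edge G -> R), nowhere_zero_flow r D phi.

(* The infimum is taken in the extended reals, where that of the empty set
   is +oo. *)
Definition circular_flow_number (R : realType) (G : multigraph) : \bar R :=
  ereal_inf [set r%:E | r in
    [set r : R | 2 <= r /\ has_nowhere_zero_flow G r]%classic]%classic.

(* Main.v *)
(** Multiplied by [4 t / r], a nowhere-zero [r]-flow takes values in
    [[l, 4 t - l]] with [l = 4 t / r], and [r = 2 + 2 / (2 t - 1)] corresponds to
    [l = 2 t - 1].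

    If [G - F] is bipartite with parts [A] and [B], the value [2 t] on [F] and
    [2 t - 1] on the other edges, directed from [A] to [B], is a flow modulo [4 t].
    Replacing [c] by [c - 4 t] on suitable edges makes it a flow; these edges
    exist because a 0/1 transshipment problem with integral demands has an
    integral solution as soon as it has a fractional one, here [c / (4 t)].

    Conversely, a positive flow with [l] close to [2 t - 1] forces every vertex to
    have in-degree [t] (this defines [A]) or [t + 1]. Read modulo [4 t] from [A]
    to its complement, its values at each vertex are at least [l] and add up to
    [4 t ^ 2], so they exceed [2 t - 1] by a total of 1. The two readings of an
    edge inside one side add up to [4 t]: this is impossible if [l > 2 t - 1], and
    otherwise both exceed [2 t - 1] by almost exactly 1. Thus the excesses on the
    remaining edges almost form a fractional perfect matching of the vertices not
    covered by inner edges, and rounding it completes the inner edges to [F].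
    As the bounds only hold up to a small error, no flow attaining the infimum is
    needed. *)

Require Import Defs.
From HB Require Import structures.
From mathcomp Require Import classical_sets reals ereal.
From mathcomp Require Import all_boot all_order all_algebra.
From mathcomp Require Import zify ring lra.

Set Implicit Arguments.
Unset Strict Implicit.
Unset Printing Implicit Defensive.

Import Order.TTheory GRing.Theory Num.Theory.

Local Open Scope ring_scope.

(** * Integral 0/1 transshipment by augmenting paths *)

Section Transshipment.
Variables (V E : finType) (tl hd : E -> V).
Implicit Types (S T : {set E}) (X : {set V}) (R : nzRingType).

Definition incidence R (e : E) (v : V) : R := (tl e == v)%:R - (hd e == v)%:R.

Lemma sum_indicator R X (u : V) : \sum_(v in X) (u == v)%:R = (u \in X)%:R :> R.
Proof.
have [uX|uX] := boolP (u \in X).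
  rewrite (bigD1 u) //= eqxx big1 ?addr0 // => v /andP[_ /negPf].
  by rewrite eq_sym => ->.
by rewrite big1 // => v vX; case: eqP uX => // ->; rewrite vX.
Qed.

Lemma sum_incidence_set R X e :
  \sum_(v in X) incidence R e v = (tl e \in X)%:R - (hd e \in X)%:R.
Proof. by rewrite sumrB !sum_indicator. Qed.

(** The residual graph of the 0/1 flow [S] within [T]: edges of [S] are traversed backwards, the
    other edges of [T] forwards. *)
Definition residual T S : rel V := fun u w =>
  [exists e, (e \in T) &&
    (if e \in S then (hd e == u) && (tl e == w)
     else (tl e == u) && (hd e == w))].

Definition net S v : int := \sum_(e in S) incidence int e v.

(** Toggling the edge behind a residual arc pushes one unit from [u] to [w]. Only arcs between [u]
    and [w] change, so those avoiding [u] survive. *)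
Lemma augment_edge T S u w : S \subset T -> residual T S u w ->
  exists S', [/\ S' \subset T,
    forall v, net S' v = net S v + (u == v)%:R - (w == v)%:R &
    forall x y, x != u -> y != u -> residual T S' x y = residual T S x y].
Proof.
move=> sST /existsP[e /andP[eT]]; case: ifP => eS /andP[/eqP eu /eqP ew].
- exists (S :\ e); split=> [|v|x y xu yu].
  + exact: subset_trans (subD1set _ _) sST.
  + rewrite /net [in RHS](big_setD1 e) //= /incidence eu ew.
    ring.
  + apply: eq_existsb => e'; congr (_ && _); rewrite in_setD1.
    case: (eqVneq e' e) => //= ->; rewrite eS eu ew.
    by rewrite [u == y]eq_sym [u == x]eq_sym (negPf xu) (negPf yu) andbF.
- exists (e |: S); split=> [|v|x y xu yu].
  + by rewrite subUset sub1set eT.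
  + rewrite /net big_setU1 ?eS //= /incidence eu ew.
    ring.
  + apply: eq_existsb => e'; congr (_ && _); rewrite in_setU1.
    case: (eqVneq e' e) => //= ->; rewrite eS eu ew.
    by rewrite [u == y]eq_sym [u == x]eq_sym (negPf xu) (negPf yu) andbF.
Qed.

(** The rest of a simple path avoids [u], so it stays residual once its first arc is augmented. *)
Lemma augment_path T S u p : S \subset T -> uniq (u :: p) ->
  path (residual T S) u p ->
  exists2 S' : {set E}, S' \subset T &
    forall v, net S' v = net S v + (u == v)%:R - (last u p == v)%:R.
Proof.
elim: p S u => [|w p IHp] S u sST.
  by exists S => // v; rewrite addrK.
move=> /andP[u_wp uniq_wp] /andP[/(augment_edge sST)[S1 [sS1T netS1 resS1]] path_wp].
have [|S' sS'T netS'] := IHp S1 w sS1T uniq_wp.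
  rewrite (@eq_in_path _ (mem (w :: p)) _ (residual T S)) //.
    by move=> x y xp yp; apply: resS1; apply: contraNneq u_wp => <-.
  by apply/allP.
by exists S' => // v; rewrite netS' netS1 subrK.
Qed.

(** A set [S] of least total defect works. Otherwise let [X] be the set reachable in the residual
    graph from a vertex with [d > 0]: a vertex of [X] with [d < 0] gives an improving path, and
    without one [X] violates the cut condition. *)
Lemma integral_transshipment T (b : V -> int) :
  \sum_v b v = 0 ->
  (forall X, \sum_(v in X) b v <=
     #|[set e in T | (tl e \in X) && (hd e \notin X)]|%:Z) ->
  exists2 S : {set E}, S \subset T & forall v, net S v = b v.
Proof.
move=> b0 cut.
pose defect S := (\sum_v `|(b v - net S v)%R|)%N.
have [S sST minS] : exists2 S : {set E}, S \subset T &
    forall S' : {set E}, S' \subset T -> (defect S <= defect S')%N.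
  case: (@arg_minnP _ set0 (fun S : {set E} => S \subset T) defect).
    exact: sub0set.
  by move=> S ? ?; exists S.
exists S => //.
pose d v := b v - net S v.
have netsum X : \sum_(v in X) net S v =
    \sum_(e in S) ((tl e \in X)%:R - (hd e \in X)%:R).
  by rewrite exchange_big; apply: eq_bigr => e _; rewrite sum_incidence_set.
have d0 : \sum_v d v = 0.
  have := netsum setT; rewrite (eq_bigl xpredT) => [nS|v]; last by rewrite inE.
  by rewrite sumrB b0 nS big1 ?subr0 // => e _; rewrite !inE subrr.
have [|/existsP[x dx]] := boolP [forall x, d x <= 0].
  move=> /forallP dle v; apply/esym/eqP; rewrite -subr_eq0 -oppr_eq0; apply/eqP.
  have/eqP : \sum_v - d v = 0 by rewrite sumrN d0 oppr0.
  rewrite psumr_eq0 => [/allP/(_ v)|i _]; last by rewrite oppr_ge0.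
  by rewrite mem_index_enum => /(_ isT)/eqP.
exfalso; rewrite -ltNge in dx.
pose X := [set y | connect (residual T S) x y].
have xX : x \in X by rewrite inE connect0.
have [/existsP[y /andP[yX dy]]|] := boolP [exists y, (y \in X) && (d y < 0)].
  move: yX dy; rewrite inE => /connectP[p0 pth ->].
  case/shortenP: pth => p pth uniq_p _ dy.
  have [S' sS'T netS'] := augment_path sST uniq_p pth.
  have := minS S' sS'T; apply/negP; rewrite -ltnNge.
  set z := last x p in dy netS'.
  have xz : x != z by apply: contraTneq dx => ->; rewrite -leNgt ltW.
  (* The defect drops at [x] and grows at no other vertex. *)
  rewrite /defect (bigD1 x) //= [in X in (_ < X)%N](bigD1 x) //=.
  rewrite -addSn leq_add //.
    rewrite netS' eqxx [z == x]eq_sym (negPf xz); move: dx; rewrite /d; lia.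
  apply: leq_sum => v vx; rewrite netS' [x == v]eq_sym (negPf vx).
  by case: (eqVneq z v) => [<-|_]; move: dy; rewrite /d; lia.
rewrite negb_exists => /forallP dge.
have dX : 0 < \sum_(v in X) d v.
  rewrite (bigD1 x) //=; apply: ltr_pwDl => //; apply: sumr_ge0 => v /andP[vX _].
  by have := dge v; rewrite vX /= -leNgt.
have := cut X; rewrite leNgt => /negP; apply; move: dX.
rewrite sumrB subr_gt0 netsum; apply: le_lt_trans.
(* No residual arc leaves [X]: edges of [T] leaving [X] lie in [S], and edges of [S] entering [X] do
   not exist. *)
have closed e : e \in T ->
  (if e \in S then (hd e \in X) ==> (tl e \in X) else (tl e \in X) ==> (hd e \in X)).
  move=> eT; case: ifP => eS; apply/implyP; rewrite !inE => /connect_trans; apply;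
  by apply/connect1/existsP; exists e; rewrite eT eS !eqxx.
set C := [set e in T | _].
have sCS : C \subset S.
  apply/subsetP => e; rewrite inE => /and3P[eT tX hX]; have := closed e eT.
  by case: ifP => // _; rewrite tX (negPf hX).
rewrite [leRHS](big_setID C) /= (setIidPr sCS).
have -> : #|C|%:Z = \sum_(e in C) ((tl e \in X)%:R - (hd e \in X)%:R).
  rewrite -natz -sumr_const; apply: eq_bigr => e.
  by rewrite inE => /and3P[_ -> /negPf ->]; rewrite subr0.
rewrite lerDl; apply: sumr_ge0 => e /setDP[eS _].
have := closed e (subsetP sST e eS); rewrite eS.
by case: (hd e \in X); case: (tl e \in X).
Qed.
End Transshipment.

(** Over any cut the errors add up to less than 1, so the cut condition, an inequality between
    integers, holds exactly. *)
Lemma integral_rounding (F : realFieldType) (V E : finType) (tl hd : E -> V)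
    (T : {set E}) (b : V -> int) (y : E -> F) (d : F) :
  0 <= d -> d * (#|V| + #|E|)%:R < 1 ->
  (forall e, e \in T -> - d <= y e <= 1 + d) ->
  (forall v, `|\sum_(e in T) y e * incidence tl hd F e v - (b v)%:~R| <= d) ->
  exists2 S : {set E}, S \subset T & forall v, net tl hd S v = b v.
Proof.
move=> d0 dlt yd bd.
have dev (X : {set V}) : `|\sum_(e in T) y e * ((tl e \in X)%:R - (hd e \in X)%:R)
    - (\sum_(v in X) b v)%:~R| <= d * #|V|%:R.
  rewrite rmorph_sum /=.
  under eq_bigr do rewrite -sum_incidence_set mulr_sumr.
  rewrite exchange_big -sumrB; apply: le_trans (ler_norm_sum _ _ _) _.
  apply: le_trans (ler_sum _ (fun v _ => bd v)) _.
  by rewrite sumr_const -[leLHS]mulr_natr ler_wpM2l ?ler_nat ?max_card.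
have dE : d * #|T|%:R <= d * #|E|%:R by rewrite ler_wpM2l // ler_nat max_card.
have dV : 0 <= d * #|V|%:R by rewrite mulr_ge0.
have dE0 : 0 <= d * #|E|%:R by rewrite mulr_ge0.
rewrite natrD mulrDr in dlt.
apply: integral_transshipment => [|X].
  have := dev setT; rewrite big1 ?sub0r => [|e _]; last by rewrite !inE subrr mulr0.
  rewrite (eq_bigl xpredT) => [|v]; last by rewrite inE.
  set s := \sum_v _; rewrite normrN -intr_norm => sd.
  have : `|s|%:~R < 1%:~R :> F by lra.
  by rewrite ltr_int; lia.
set C := [set e in T | _].
rewrite -ltzD1 -(ltr_int F) rmorphD /=; set s := \sum_(v in X) _ in dev *.
have : \sum_(e in T) y e * ((tl e \in X)%:R - (hd e \in X)%:R) <=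
    \sum_(e in T) ((e \in C)%:R + d).
  apply: ler_sum => e eT; have := yd e eT; rewrite inE eT /=.
  by case: (tl e \in X); case: (hd e \in X) => /=; lra.
rewrite big_split /= sumr_const -[d *+ _]mulr_natr.
have -> : \sum_(e in T) (e \in C)%:R = #|C|%:R :> F.
  rewrite -sum1_card natr_sum (big_setID C) /= (setIidPr _) ?subsetIl //.
    rewrite [X in _ + X]big1 ?addr0 => [|e]; last by rewrite inE => /andP[/negPf ->].
    by apply: eq_bigr => e ->.
  by apply/subsetP => e; rewrite inE => /andP[].
have := dev X; rewrite ler_distl => /andP[devX _] yC.
change ((Posz #|C|)%:~R) with (#|C|%:R : F); lra.
Qed.

(** * Orientations and positive flows *)

Section Orientation.
Variables (R : realType) (G : multigraph).

Lemma flow_incidence (D : orientation G) (phi : edge G -> R) v :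
  \sum_e phi e * incidence (tail D) (Defs.head D) R e v =
  \sum_(e in out_edges D v) phi e - \sum_(e in in_edges D v) phi e.
Proof.
rewrite [X in X - _]big_mkcond [X in _ - X]big_mkcond -sumrB.
apply: eq_bigr => e _; rewrite !inE /incidence.
by case: eqP => _; case: eqP => _ /=; ring.
Qed.

Lemma tail_neq_head (D : orientation G) e : tail D e != Defs.head D e.
Proof. by have := card_ends e; rewrite (ends_tail_head D) cards2; case: (_ != _). Qed.

Lemma in_ends (D : orientation G) e v :
  (v \in ends e) = (v == tail D e) || (v == Defs.head D e).
Proof. by rewrite (ends_tail_head D) !inE. Qed.

(* Reversing the edges that carry a negative value makes a flow positive. *)
Lemma positive_flow (r c : R) : 2 <= r -> 0 <= c -> has_nowhere_zero_flow G r ->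
  exists (D : orientation G) (psi : edge G -> R),
    (forall e, c / r <= psi e <= c - c / r) /\
    (forall v, \sum_e psi e * incidence (tail D) (Defs.head D) R e v = 0).
Proof.
move=> r2 c0 [D [phi [phi_bd cons]]].
pose tl e := if phi e < 0 then Defs.head D e else tail D e.
pose hd e := if phi e < 0 then tail D e else Defs.head D e.
have ends_tlhd e : ends e = [set tl e; hd e].
  by rewrite (ends_tail_head D) /tl /hd; case: ifP => // _; rewrite setUC.
exists (Orientation ends_tlhd), (fun e => c / r * `|phi e|).
have cr0 : 0 <= c / r by rewrite divr_ge0 //; lra.
split=> [e|v].
  have crr : c / r * r = c by rewrite divfK //; lra.
  have := phi_bd e; set p := `|phi e| => /andP[p1 pr].
  by apply/andP; split; nra.
under eq_bigr do rewrite -mulrA.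
rewrite -mulr_sumr; apply/eqP; rewrite mulf_eq0; apply/orP; right; apply/eqP.
rewrite -[RHS](subrr (\sum_(e in out_edges D v) phi e)) {2}cons -flow_incidence.
apply: eq_bigr => e _; rewrite /incidence /= /tl /hd.
by case: ltrP => phi0; [rewrite ltr0_norm|rewrite ger0_norm] => //; ring.
Qed.
End Orientation.

(** * Edges between a set and its complement *)

Lemma card_pair_setI (V : finType) (A : {set V}) u w :
  (u \in A) != (w \in A) -> #|[set u; w] :&: A| = 1%N.
Proof.
wlog uA : u w / u \in A => [IH uwA|].
  have [uA|uA] := boolP (u \in A); first exact: IH.
  by rewrite setUC; apply: IH; [case: (w \in A) uA uwA; case: (u \in A)|rewrite eq_sym].
rewrite uA eq_sym eqb_id => wA; have -> : [set u; w] :&: A = [set u]; last by rewrite cards1.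
apply/setP => v; rewrite !inE; case: eqP => [->|_] //=.
by case: eqP => //= ->; rewrite (negPf wA).
Qed.

Lemma card_pair_setI_setC (V : finType) (A : {set V}) u w :
  (u \in A) != (w \in A) ->
  #|[set u; w] :&: A| = 1%N /\ #|[set u; w] :&: ~: A| = 1%N.
Proof.
move=> uw; split; apply: card_pair_setI => //.
by rewrite !inE; case: (u \in A) uw; case: (w \in A).
Qed.

(** Turns net outflow, up to a sign given by the side of [v], into a sum over the edges at [v]. *)
Lemma incidence_directed (S : nzRingType) (V : finType) (A : {set V}) u w v :
  u \in A -> w \notin A ->
  (u == v)%:R - (w == v)%:R = (-1) ^+ (v \notin A) * (v \in [set u; w])%:R :> S.
Proof.
move=> uA wA; rewrite !inE.
case: (eqVneq v u) => [->|_].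
  by rewrite uA; case: (eqVneq w u) wA => [->|_ _]; rewrite ?uA //= subr0 mulr1.
case: (eqVneq v w) => [->|_]; last by rewrite subrr mulr0.
by rewrite wA sub0r mulr1.
Qed.

(** * Positive flows whose least value is large *)

Section PositiveFlow.
Variables (R : realType) (t : nat) (G : multigraph).
Hypothesis t_gt0 : (0 < t)%N.
Hypothesis G_reg : regular (2 * t + 1) G.
Variables (D : orientation G) (psi : edge G -> R) (l : R).
Hypothesis psi_bounds : forall e, l <= psi e <= 4 * t%:R - l.
Hypothesis psi_cons :
  forall v, \sum_e psi e * incidence (tail D) (Defs.head D) R e v = 0.
Hypothesis l_gt : 4 * t%:R * (t%:R - 1) < (2 * t%:R + 1) * l.

Let t_ge1 : 1 <= t%:R :> R. Proof. by rewrite ler1n. Qed.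

Lemma sum_ends (M : nmodType) (f : edge G -> M) v :
  \sum_(e | v \in ends e) f e =
  \sum_(e in out_edges D v) f e + \sum_(e in in_edges D v) f e.
Proof.
rewrite (bigID (fun e => tail D e == v)) /=; congr (_ + _); apply: eq_bigl => e.
  by rewrite inE (in_ends D) [v == tail _ _]eq_sym; case: (_ == v); rewrite ?andbF.
rewrite inE (in_ends D) [v == tail _ _]eq_sym [v == _]eq_sym.
case: (eqVneq (tail D e) v) => [<-|_]; last by rewrite andbT.
by rewrite [RHS]eq_sym (negPf (tail_neq_head _ _)) andbF.
Qed.

Lemma card_out_in v : (#|out_edges D v| + #|in_edges D v| = 2 * t + 1)%N.
Proof.
rewrite -(G_reg v) /degree -!sum1_card.
apply: etrans (esym (sum_ends (fun=> 1%N) v)) _.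
by apply: eq_bigl => e; rewrite inE.
Qed.

Lemma psi_balanced v :
  \sum_(e in out_edges D v) psi e = \sum_(e in in_edges D v) psi e.
Proof. by apply/eqP; rewrite -subr_eq0 -flow_incidence psi_cons. Qed.

Lemma sum_bounds (a c : R) (f : edge G -> R) (S : {set edge G}) :
  (forall e, a <= f e <= c) ->
  a * #|S|%:R <= \sum_(e in S) f e <= c * #|S|%:R.
Proof.
move=> fb; rewrite !mulr_natr -!sumr_const.
by rewrite !ler_sum // => e _; case/andP: (fb e).
Qed.

(** With in-degree [i] and out-degree [o], balance gives [l * o <= (4 t - l) * i], that is
    [(2 t + 1) * l <= 4 t * i], so [l_gt] forces [t <= i]. Symmetrically [t <= o], and
    [i + o = 2 t + 1]. *)
Lemma card_in_edges v : (#|in_edges D v| == t) || (#|out_edges D v| == t).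
Proof.
have /andP[o1 o2] := sum_bounds (out_edges D v) psi_bounds.
have /andP[i1 i2] := sum_bounds (in_edges D v) psi_bounds.
have oi := card_out_in v; rewrite psi_balanced in o1 o2.
have oiR : #|out_edges D v|%:R + #|in_edges D v|%:R = 2 * t%:R + 1 :> R.
  by rewrite -natrD oi natrD natrM.
have gt (a : nat) : (2 * t%:R + 1) * l <= 4 * t%:R * a%:R -> (t <= a)%N.
  move=> la; rewrite -ltnS -(ltr_nat R) -natr1 -ltrBlDr.
  have t4 : 0 < 4 * t%:R :> R by have := t_ge1; lra.
  rewrite -(ltr_pM2l t4).
  exact: lt_le_trans l_gt la.
have ti : (t <= #|in_edges D v|)%N by apply: gt; rewrite -oiR; nra.
have to : (t <= #|out_edges D v|)%N by apply: gt; rewrite -oiR; nra.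
by lia.
Qed.

Definition few_in : {set vertex G} := [set v | #|in_edges D v| == t].

Local Notation A := few_in.

(* On an edge between [A] and its complement the two values agree, on an edge
   with both ends on the same side they add up to [4 t]: modulo [4 t], this is
   [psi] directed from [A] to its complement. *)
Definition weight (e : edge G) (v : vertex G) : R :=
  if (v \in A) == (v == tail D e) then psi e else 4 * t%:R - psi e.

Lemma weight_bounds e v : l <= weight e v <= 4 * t%:R - l.
Proof.
have /andP[] := psi_bounds e.
by rewrite /weight; case: ifP => *; apply/andP; split; lra.
Qed.

(** Exactly [t] edges at [v] are read as [4 t - psi]: the incoming ones if [v] is in [A], the
    outgoing ones otherwise. The values of [psi] cancel by balance. *)
Lemma sum_weight v : \sum_(e | v \in ends e) weight e v = 4 * t%:R * t%:R.
Proof.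
rewrite sum_ends.
under eq_bigr => e do rewrite inE /weight => /eqP->; rewrite eqxx.
rewrite [X in _ + X](_ : _ = \sum_(e in in_edges D v)
    (if v \in A then 4 * t%:R - psi e else psi e)); last first.
  apply: eq_bigr => e; rewrite inE /weight => /eqP <-.
  by rewrite [_ == tail D e]eq_sym (negPf (tail_neq_head _ _)); case: (_ \in A).
have bal := psi_balanced v.
have := card_in_edges v; have : (v \in A) = (#|in_edges D v| == t) by rewrite inE.
case: (v \in A) => /esym; first move/eqP=> it _.
  by rewrite sumrB sumr_const it -[_ *+ t]mulr_natr bal; ring.
move=> -> /= /eqP ot.
by rewrite sumrB sumr_const ot -[_ *+ t]mulr_natr bal; ring.
Qed.

(** The other [2 t] edges at [v] weigh at least [l] each. *)
Lemma weight_le e v : v \in ends e -> weight e v <= 4 * t%:R * t%:R - 2 * t%:R * l.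
Proof.
move=> ve; have := sum_weight v; rewrite (bigD1 e) //=.
pose S := [set e' | v \in ends e'] :\ e.
have cS : #|S| = (2 * t)%N.
  by have := G_reg v; rewrite /degree (cardsD1 e) inE ve -/S; lia.
rewrite (eq_bigl (mem S)) => [|e']; last by rewrite !inE andbC.
have /andP[] := sum_bounds S (weight_bounds ^~ v).
by rewrite cS natrM; lra.
Qed.

Definition inner : {set edge G} := [set e | (tail D e \in A) == (Defs.head D e \in A)].

Lemma weight_inner e : e \in inner ->
  weight e (tail D e) + weight e (Defs.head D e) = 4 * t%:R.
Proof.
rewrite inE /weight eqxx [_ == tail D e]eq_sym (negPf (tail_neq_head _ _)) => /eqP->.
by case: (_ \in A) => /=; ring.
Qed.

Lemma weight_cross e v : e \notin inner -> v \in ends e ->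
  weight e v = if tail D e \in A then psi e else 4 * t%:R - psi e.
Proof.
rewrite inE (in_ends D) /weight => cross /orP[] /eqP->.
  by rewrite eqxx; case: (_ \in A).
rewrite [_ == tail D e]eq_sym (negPf (tail_neq_head _ _)).
by case: (tail D e \in A) cross; case: (_ \in A).
Qed.

Lemma cross_card_ends e : e \notin inner ->
  #|ends e :&: A| = 1%N /\ #|ends e :&: ~: A| = 1%N.
Proof. by rewrite inE (ends_tail_head D) => /card_pair_setI_setC. Qed.

(** The two weights of an inner edge would add up to at most [8 t ^ 2 - 4 t l < 4 t], against
    [weight_inner]. *)
Lemma bipartite_of_large_min : 2 * t%:R - 1 < l -> bipartite G.
Proof.
move=> l_large; exists A => e; apply: cross_card_ends; apply/negP => ein.
have := weight_inner ein.
have : 0 < t%:R * (l - (2 * t%:R - 1)) by rewrite mulr_gt0 ?subr_gt0 // ltr0n.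
have := @weight_le e (tail D e); rewrite (in_ends D) eqxx => /(_ isT).
have := @weight_le e (Defs.head D e); rewrite (in_ends D) eqxx orbT => /(_ isT).
by lra.
Qed.

(** * Extracting the 1-factor from an almost optimal flow *)

Section AlmostOptimal.
Variable eps : R.
Hypothesis eps_ge0 : 0 <= eps.
Hypothesis l_ge : 2 * t%:R - 1 - eps <= l.
(** An error of [2 t eps] on each of the [2 t + 1] edges at a vertex. *)
Let d : R := (2 * t%:R + 1) * (2 * t%:R * eps).
Hypothesis d_small : d * (#|vertex G| + #|edge G|)%:R < 1.

Lemma weight_le_eps e v : v \in ends e -> weight e v <= 2 * t%:R + 2 * t%:R * eps.
Proof.
have : 0 <= t%:R * (l - (2 * t%:R - 1 - eps)) by rewrite mulr_ge0 ?subr_ge0.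
by move=> ? /weight_le; lra.
Qed.

Lemma weight_inner_near e v : e \in inner -> v \in ends e ->
  `|weight e v - 2 * t%:R| <= 2 * t%:R * eps.
Proof.
move=> ein; have := weight_inner ein.
have := @weight_le_eps e (tail D e); rewrite (in_ends D) eqxx => /(_ isT) w1.
have := @weight_le_eps e (Defs.head D e); rewrite (in_ends D) eqxx orbT => /(_ isT) w2 w12.
by rewrite (in_ends D) ler_norml => /orP[] /eqP->; apply/andP; split; lra.
Qed.

Let src e := if tail D e \in A then tail D e else Defs.head D e.
Let tgt e := if tail D e \in A then Defs.head D e else tail D e.

Lemma incidence_cross (S : nzRingType) e v : e \notin inner ->
  incidence src tgt S e v = (-1) ^+ (v \notin A) * (v \in ends e)%:R.
Proof.
rewrite inE (ends_tail_head D) /incidence /src /tgt => cross.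
have [tA|tA] := boolP (tail D e \in A).
  by apply: incidence_directed; rewrite tA in cross *.
by rewrite setUC; apply: incidence_directed; move: cross; rewrite (negPf tA); case: (_ \in A).
Qed.

Let inner_degree v := #|[set e in inner | v \in ends e]|.

(** [S] is to supply the [1 - inner_degree v] edges that [v] still lacks. With cross edges directed
    from [A] to its complement, this is a transshipment problem. *)
Lemma cross_rounding : exists2 S : {set edge G}, S \subset ~: inner &
  forall v, net src tgt S v = (-1) ^+ (v \notin A) * (1 - (inner_degree v)%:Z).
Proof.
have t1 := t_ge1.
(* The excess over [2 t - 1] of the common weight of a cross edge at its ends; it lies between
   [- eps] and [1 + 2 t eps]. *)
pose y e :=
  (if tail D e \in A then psi e else 4 * t%:R - psi e) - (2 * t%:R - 1).
have te0 : 0 <= t%:R * eps by rewrite mulr_ge0 //; lra.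
have te_le : eps <= t%:R * eps by rewrite ler_peMl.
have te2_le : t%:R * eps <= t%:R * (t%:R * eps) by rewrite ler_peMl.
have dE : d = 4 * (t%:R * (t%:R * eps)) + 2 * (t%:R * eps) by rewrite /d; ring.
have d0 : 0 <= d by lra.
apply: (@integral_rounding R _ _ src tgt _ _ y d) => // [e|v].
  rewrite inE => cross.
  have te : tail D e \in ends e by rewrite (in_ends D) eqxx.
  have := weight_le_eps te; have /andP[+ _] := weight_bounds e (tail D e).
  rewrite (weight_cross cross te) /y; move: (if _ then _ else _) => p w1 w2.
  have e0 := eps_ge0; have l1 := l_ge.
  by apply/andP; split; lra.
pose z e := weight e v - (2 * t%:R - 1).
have -> : \sum_(e in ~: inner) y e * incidence src tgt R e v =
    (-1) ^+ (v \notin A) * \sum_(e in ~: inner | v \in ends e) z e.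
  rewrite big_mkcondr mulr_sumr; apply: eq_bigr => e; rewrite inE => cross.
  rewrite incidence_cross // mulrCA; congr (_ * _); case: ifP => ve.
    by rewrite mulr1 /z weight_cross.
  by rewrite mulr0.
rewrite rmorphM rmorph_sign rmorphB rmorph1 /= -mulrBr normrM normr_sign mul1r.
(* [4 t ^ 2 - (2 t + 1) (2 t - 1) = 1]. *)
have sz : \sum_(e | v \in ends e) z e = 1.
  rewrite sumrB sum_weight sumr_const -(eq_card (_ : [set e | v \in ends e] =i _)); last first.
    by move=> e; rewrite inE.
  by rewrite -/(degree v) G_reg -[X in _ - X]mulr_natr natrD natrM; ring.
rewrite (bigID (mem inner)) /= addrC in sz.
rewrite (eq_bigl (fun e => (v \in ends e) && (e \notin inner))); last first.
  by move=> e; rewrite inE andbC.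
have -> : (\sum_(e | (v \in ends e) && (e \notin inner)) z e) =
    1 - \sum_(e | (v \in ends e) && (e \in inner)) z e by rewrite -sz addrK.
have -> : (inner_degree v)%:Z%:~R = \sum_(e | (v \in ends e) && (e \in inner)) 1 :> R.
  by rewrite sumr_const -pmulrn; congr (_ *+ _); apply: eq_card => e; rewrite in_set andbC.
rewrite opprD opprK addrACA subrr add0r addrC -sumrB.
apply: le_trans (ler_norm_sum _ _ _) _.
apply: (@le_trans _ _ (\sum_(e in [set e | v \in ends e]) (2 * t%:R * eps))).
  rewrite [leRHS](eq_bigl (fun e => v \in ends e)); last by move=> e; rewrite inE.
  rewrite [leRHS](bigID (mem inner)) /= -[leLHS]addr0 lerD //.
    apply: ler_sum => e /andP[ve ein]; rewrite distrC /z.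
    have -> : weight e v - (2 * t%:R - 1) - 1 = weight e v - 2 * t%:R by ring.
    exact: weight_inner_near.
  by apply: sumr_ge0 => *; lra.
by rewrite sumr_const -/(degree v) G_reg -[leLHS]mulr_natr natrD natrM /d mulrC.
Qed.

Lemma bipartite_factor : exists F : {set edge G}, one_factor F /\ bipartite (delete_edges F).
Proof.
have [S Scross netS] := cross_rounding.
exists (inner :|: S); split=> [v|]; last first.
  exists A => -[e /= eF]; apply: cross_card_ends.
  by apply: contra eF => ein; rewrite inE ein.
have netv : net src tgt S v = (-1) ^+ (v \notin A) * #|[set e in S | v \in ends e]|%:Z.
  rewrite /net -natz -sum1_card natr_sum mulr_sumr.
  rewrite [RHS](eq_bigl (fun e => (e \in S) && (v \in ends e))); last by move=> e; rewrite inE.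
  rewrite big_mkcondr; apply: eq_bigr => e eS.
  have := subsetP Scross e eS; rewrite inE => /incidence_cross->.
  by case: ifP; rewrite ?mulr0.
(* This equation between integers also shows that at most one inner edge meets [v]. *)
have := netS v; rewrite netv => /(can_inj (signrMK _)) degS.
have -> : [set e in inner :|: S | v \in ends e] =
    [set e in inner | v \in ends e] :|: [set e in S | v \in ends e].
  by apply/setP => e; rewrite !inE andb_orl.
rewrite cardsU (_ : _ :&: _ = set0) ?cards0 ?subn0; last first.
  apply/setP => e; rewrite !in_setI !inE -!andbA; apply/negP => /and4P[ein _ eS _].
  by have := subsetP Scross e eS; rewrite !inE ein.
by apply/eqP; rewrite -eqz_nat PoszD degS addrCA subrr addr0.
Qed.
End AlmostOptimal.
End PositiveFlow.

(** * Constructing a flow from a 1-factor *)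

Lemma flow_of_factor (R : realType) (t : nat) (G : multigraph) (F : {set edge G}) :
  (0 < t)%N -> regular (2 * t + 1) G -> one_factor F ->
  bipartite (delete_edges F) ->
  has_nowhere_zero_flow G (2 + 2 / (2 * t%:R - 1) : R).
Proof.
move=> t_gt0 G_reg F_factor [A0 bipA0].
have [A bipA] : exists A : {set vertex G}, forall e, e \notin F ->
    #|ends e :&: A| = 1%N /\ #|ends e :&: ~: A| = 1%N.
  by exists A0 => e eF; apply: (bipA0 (exist _ e eF)).
have t1 : 1 <= t%:R :> R by rewrite ler1n.
(* Edges outside [F] are directed from [A] to its complement, edges of [F] arbitrarily. *)
have exD (e : edge G) : exists uw : vertex G * vertex G,
    ends e = [set uw.1; uw.2] /\ (e \notin F -> uw.1 \in A /\ uw.2 \notin A).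
  have /eqP/cards2P[u [w [_ e_uw]]] := card_ends e.
  have [eF|eF] := boolP (e \in F); first by exists (u, w).
  have [] := bipA e eF; rewrite e_uw => A1 A2.
  have [uA|uA] := boolP (u \in A); have [wA|wA] := boolP (w \in A).
  - by move: A2; rewrite (_ : _ :&: _ = set0) ?cards0 //; apply/setP => v;
      rewrite !inE; do 2?case: eqP => [->|_]; rewrite ?uA ?wA.
  - by exists (u, w).
  - by exists (w, u); rewrite /= setUC.
  - by move: A1; rewrite (_ : _ :&: _ = set0) ?cards0 //; apply/setP => v;
      rewrite !inE; do 2?case: eqP => [->|_]; rewrite ?(negPf uA) ?(negPf wA).
have [uw uwP] := fin_all_exists exD.
have ends_uw e : ends e = [set (uw e).1; (uw e).2] by case: (uwP e).
pose D := Orientation ends_uw.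
pose inc := incidence (tail D) (Defs.head D) R.
pose y (e : edge G) : R := if e \in F then 1 / 2 else (2 * t%:R - 1) / (4 * t%:R).
pose out v := #|[set e in F | tail D e == v]|.
(* The net outflow of [y]: [F] contributes [out v - 1 / 2], the other edges [t - 1 / 2] on [A] and
   its opposite elsewhere, so the halves combine to an integer. *)
pose b v : int := (if v \in A then t%:Z - 1 else - t%:Z) + (out v)%:Z.
have F_ends v : \sum_(e in F) (v \in ends e)%:R = 1 :> R.
  transitivity (#|[set e in F | v \in ends e]|%:R : R); last by rewrite F_factor.
  rewrite -sum1_card natr_sum.
  rewrite [RHS](eq_bigl (fun e => (e \in F) && (v \in ends e))); last by move=> e; rewrite inE.
  by rewrite [RHS]big_mkcondr; apply: eq_bigr => e _; case: ifP.
have nF_ends v : \sum_(e in ~: F) (v \in ends e)%:R = 2 * t%:R :> R.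
  have : \sum_e (v \in ends e)%:R = (2 * t + 1)%:R :> R.
    rewrite -(G_reg v) /degree -sum1_card natr_sum [RHS]big_mkcond /=.
    by apply: eq_bigr => e _; rewrite inE; case: ifP.
  rewrite (bigID (mem F)) /= F_ends natrD natrM => sE.
  rewrite (eq_bigl (fun e => e \notin F)); last by move=> e; rewrite inE.
  by lra.
have F_inc v : \sum_(e in F) inc e v = 2 * (out v)%:R - 1.
  have -> : (out v)%:R = \sum_(e in F) (tail D e == v)%:R :> R.
    rewrite /out -sum1_card natr_sum.
    rewrite (eq_bigl (fun e => (e \in F) && (tail D e == v))); last by move=> e; rewrite inE.
    by rewrite big_mkcondr; apply: eq_bigr => e _; case: ifP.
  rewrite -[X in _ = _ - X](F_ends v) mulr_sumr -sumrB; apply: eq_bigr => e _.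
  rewrite (in_ends D) /inc /incidence ![v == _]eq_sym.
  have := tail_neq_head D e.
  case: (eqVneq (tail D e) v) => [->|_] th; last by case: (_ == v) => /=; ring.
  by rewrite [_ == v]eq_sym (negPf th) /=; ring.
have nF_inc v : \sum_(e in ~: F) inc e v = (-1) ^+ (v \notin A) * (2 * t%:R).
  rewrite -(nF_ends v) mulr_sumr; apply: eq_bigr => e; rewrite inE => eF.
  have [_ /(_ eF)[uA wA]] := uwP e.
  by rewrite (ends_tail_head D); apply: incidence_directed.
have y_net v : \sum_e y e * inc e v = (b v)%:~R.
  rewrite (bigID (mem F)) /=.
  have -> : \sum_(e in F) y e * inc e v = 1 / 2 * (2 * (out v)%:R - 1).
    by rewrite -F_inc mulr_sumr; apply: eq_bigr => e eF; rewrite /y eF.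
  have -> : \sum_(e | e \notin F) y e * inc e v =
      (2 * t%:R - 1) / (4 * t%:R) * ((-1) ^+ (v \notin A) * (2 * t%:R)).
    rewrite -nF_inc mulr_sumr; apply: eq_big => [e|e eF]; first by rewrite inE.
    by rewrite /y (negPf eF).
  rewrite /b rmorphD /= -pmulrn; case: (v \in A) => /=; rewrite ?rmorphB ?rmorphN /= -?pmulrn.
    by field; lra.
  by field; lra.
have [||e _|v|S _ netS] := @integral_rounding R _ _ (tail D) (Defs.head D) setT b y 0.
- by [].
- by rewrite mul0r.
- rewrite /y oppr0 addr0; case: ifP => _; first by apply/andP; split; lra.
  by apply/andP; split; [rewrite divr_ge0 //|rewrite ler_pdivrMr]; lra.
- rewrite (eq_bigl xpredT) => [|e]; last by rewrite inE.
  by rewrite y_net subrr normr0.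
pose m : R := 2 * t%:R - 1; have m0 : 0 < m by rewrite /m; lra.
(* [k] is the target [r]. The flow takes the values [r / 2] or [- r / 2] on [F], and [1] or [1 - r]
   elsewhere. *)
pose k := 4 * t%:R / m.
exists D, (fun e => k * (y e - (e \in S)%:R)); split=> [e|v].
  have i0 : 0 < m^-1 by rewrite invr_gt0.
  have kE : k = 2 + 2 * m^-1 by rewrite /k /m; field; move: m0; rewrite /m; lra.
  have kc : k * ((2 * t%:R - 1) / (4 * t%:R)) = 1.
    by rewrite /k /m; field; move: m0; rewrite /m; lra.
  rewrite mulrBr /y -/m; case: ifP => _; last rewrite kc; rewrite kE.
    case: (e \in S).
      by rewrite ler0_norm /=; [apply/andP; split|]; lra.
    by rewrite ger0_norm /=; [apply/andP; split|]; lra.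
  case: (e \in S).
    by rewrite ler0_norm /=; [apply/andP; split|]; lra.
  by rewrite ger0_norm /=; [apply/andP; split|]; lra.
apply/eqP; rewrite -subr_eq0 -flow_incidence; apply/eqP.
under eq_bigr do rewrite -mulrA mulrBl.
rewrite -mulr_sumr sumrB y_net -netS /net rmorph_sum /=.
rewrite (_ : \sum_(e in S) _ = \sum_e (e \in S)%:R * inc e v) ?subrr ?mulr0 //.
rewrite big_mkcond; apply: eq_bigr => e _; case: ifP => _; last by rewrite mul0r.
by rewrite mul1r /inc /incidence rmorphB /= !rmorph_nat.
Qed.

(** * The circular flow number and the 1-factor *)

Theorem theorem2p3 (R : realType) (t : nat) (G : multigraph)
    (t_ge1 : (1 <= t)%N)
    (G_reg : regular (2 * t + 1)%N G)
    (G_nonbip : ~ bipartite G) :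
  (exists F : {set edge G}, one_factor F /\ bipartite (delete_edges F)) <->
  circular_flow_number R G = (2 + 2 / (2 * t%:R - 1))%:E.
Proof.
have t1 : 1 <= t%:R :> R by rewrite ler1n.
set r0 : R := 2 + 2 / (2 * t%:R - 1).
have r0m : r0 * (2 * t%:R - 1) = 4 * t%:R by rewrite /r0; field; lra.
have r0_ge2 : 2 <= r0 by rewrite lerDl divr_ge0 //; lra.
have c0 : 0 <= 4 * t%:R :> R by lra.
split=> [[F [F_factor F_bip]]|cfn].
  apply/eqP; rewrite eq_le; apply/andP; split.
    by apply: ereal_inf_lbound; exists r0 => //; split=> //; apply: flow_of_factor.
  apply/ereal_infP => _ [r [r_ge2 r_flow] <-]; rewrite lee_fin leNgt; apply/negP => r_lt.
  have [D [psi [psi_bounds psi_cons]]] := positive_flow r_ge2 c0 r_flow.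
  have l_large : 2 * t%:R - 1 < 4 * t%:R / r.
    have : 0 < (2 * t%:R - 1) * (r0 - r) by rewrite mulr_gt0 ?subr_gt0 //; lra.
    by rewrite ltr_pdivlMr; lra.
  apply/G_nonbip/(bipartite_of_large_min t_ge1 G_reg psi_bounds psi_cons) => //.
  move: (4 * t%:R / r) l_large => l; rewrite -subr_gt0 => l_large.
  have : 0 < (2 * t%:R + 1) * (l - (2 * t%:R - 1)) by rewrite mulr_gt0 //; lra.
  by lra.
pose N : R := (#|vertex G| + #|edge G|)%:R; have N0 : 0 <= N by rewrite ler0n.
(* For [eps = 1 / K] the first summand of [K] bounds the rounding error by [1 - 3 eps]; the summand
   3 gives [eps <= 1 / 3], used for the degree condition on [l]. *)
pose K : R := (2 * t%:R + 1) * (2 * t%:R) * N + 3.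
have K3 : 3 <= K by rewrite lerDr !mulr_ge0 //; lra.
have [eps eps0 epsK] : exists2 eps : R, 0 < eps & eps * K = 1.
  by exists K^-1; [rewrite invr_gt0|rewrite mulVf]; lra.
have eps3 : eps * 3 <= 1 by rewrite -[leRHS]epsK ler_wpM2l // ltW.
have m_gt : 0 < 2 * t%:R - 1 - eps by lra.
(* Since [r0 = 4 t / (2 t - 1)] lies strictly below this bound, some flow has [r] below it too,
   which gives [4 t / r > 2 t - 1 - eps]. *)
have : (circular_flow_number R G < (4 * t%:R / (2 * t%:R - 1 - eps))%:E)%E.
  have re : 0 < r0 * eps by rewrite mulr_gt0 //; lra.
  by rewrite cfn lte_fin ltr_pdivlMr //; lra.
move=> /ereal_inf_lt[_ [r [r_ge2 r_flow] <-]].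
rewrite lte_fin ltr_pdivlMr // mulrC => r_lt.
have [D [psi [psi_bounds psi_cons]]] := positive_flow r_ge2 c0 r_flow.
have l_gt : 2 * t%:R - 1 - eps < 4 * t%:R / r by rewrite ltr_pdivlMr //; lra.
apply: (bipartite_factor t_ge1 G_reg psi_bounds psi_cons _ (ltW eps0) (ltW l_gt)).
  move: (4 * t%:R / r) l_gt => l; rewrite -subr_gt0 => l_gt.
  have : 0 < (2 * t%:R + 1) * (l - (2 * t%:R - 1 - eps)) by rewrite mulr_gt0 //; lra.
  have : 0 <= t%:R * (1 - eps * 3) by rewrite mulr_ge0 //; lra.
  by lra.
rewrite -/N -[ltRHS]epsK.
have -> : eps * K = (2 * t%:R + 1) * (2 * t%:R * eps) * N + 3 * eps by rewrite /K; ring.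
by lra.
Qed.
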